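(* Let $S=\langle a_1,\ldots,a_e\rangle$ be a numerical semigroup with minimal generators $a_1<\cdots<a_e$ and genus $g$. Then $a_e=2g+1$ if and only if $S'=S\setminus\{a_e\}$ is a symmetric numerical semigroup. Moreover, in case $a_e=2g+1$: if $e=2$, then $a_1=2$ and $S'=\langle 2,a_e+2\rangle$; and if $e>2$, then $S'=\langle a_1,\ldots,a_{e-1}\rangle$. In both of these cases $m(S')=m(S)$.
   Context: A numerical semigroup is a submonoid $S$ of $(\mathbb{N},+)$ (with $0\in\mathbb{N}$) whose complement in $\mathbb{N}$ is finite. It has a unique finite minimal generating set. Writing $S=\langle a_1,\ldots,a_e\rangle$ with $a_1<\cdots<a_e$ means that $a_1,\ldots,a_e$ are exactly the minimal generators of $S$; $e$ is the embedding dimension and $m(S)=a_1$ is the multiplicity of $S$ (its smallest positive element). The genus $g=g(S)$ is the number of positive integers not in $S$. The Frobenius element $F(S)$ is the largest integer not in $S$. The semigroup $S$ is symmetric if for every integer $z$ exactly one of $z$ and $F(S)-z$ lies in $S$; equivalently, $2g(S)=F(S)+1$. *)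

(* Defs.v *)
From mathcomp Require Import all_boot all_order all_algebra.
From mathcomp Require Import finmap.
From mathcomp Require Import zify.
From mathcomp Require Import mathcomp_extra boolp classical_sets functions cardinality.
Set Implicit Arguments.
Unset Strict Implicit.
Unset Printing Implicit Defensive.

Import Order.TTheory GRing.Theory Num.Theory.
Local Open Scope classical_set_scope.

Definition submonoid (M : set nat) : Prop :=
  M 0 /\ forall x y, M x -> M y -> M (x + y).

Definition numerical_semigroup (S : set nat) : Prop :=
  submonoid S /\ finite_set (~` S).

Definition generated (A : set nat) : set nat := smallest submonoid A.

Definition minimal_generating_set (S A : set nat) : Prop :=
  generated A = S /\ forall B, B `<=` A -> generated B = S -> B = A.

(* The convention S = <a_1, ..., a_e> with a_1 < ... < a_e: the a_i are exactly
   the minimal generators of S, listed increasingly. *)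
Definition minimal_generators (S : set nat) (a : seq nat) : Prop :=
  sorted ltn a /\ minimal_generating_set S [set` a].

Definition genus (S : set nat) : nat :=
  #|` fset_set [set n | 0 < n /\ ~ S n] |%fset.

Definition is_multiplicity (S : set nat) (m : nat) : Prop :=
  [/\ S m, 0 < m & forall n, S n -> 0 < n -> m <= n].

(* The default 0 is never used for a numerical semigroup, see multiplicityP. *)
Definition multiplicity (S : set nat) : nat := xget 0 (is_multiplicity S).

(* S as a set of integers. *)
Definition intset (S : set nat) : set int := Posz @` S.

Definition is_frobenius (S : set nat) (F : int) : Prop :=
  ~ intset S F /\ forall z : int, ~ intset S z -> (z <= F)%R.

(* The Frobenius element is an integer, since it is -1 for S = nat.  The default
   0 is never used for a numerical semigroup, see frobeniusP. *)
Definition frobenius (S : set nat) : int := xget 0%R (is_frobenius S).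

Definition symmetric_semigroup (S : set nat) : Prop :=
  forall z : int,
    (intset S z /\ ~ intset S (frobenius S - z)%R) \/
    (~ intset S z /\ intset S (frobenius S - z)%R).

Lemma numerical_semigroup_bound (S : set nat) : numerical_semigroup S ->
  exists N, forall n, N <= n -> S n.
Proof.
move=> [_ /finite_seqP[s sE]]; exists (\max_(i <- s) i).+1 => n ltn.
apply: contrapT => nS; have : [set` s] n by rewrite -sE.
move=> /= ns; move: ltn; rewrite ltnNge => /negP; apply.
exact: (@leq_bigmax_seq _ s xpredT id).
Qed.

Lemma multiplicityP (S : set nat) : numerical_semigroup S ->
  is_multiplicity S (multiplicity S).
Proof.
move=> /numerical_semigroup_bound[N SN].
have exS : exists n, `[< S n >] && (0 < n).
  by exists N.+1; rewrite andbT; apply/asboolP/SN.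
case: (ex_minnP exS) => m /andP[/asboolP Sm m0] min_m.
apply: (@xgetPex _ 0 (is_multiplicity S)); exists m; split=> // n Sn n0.
by apply: min_m; rewrite n0 andbT; apply/asboolP.
Qed.

Lemma frobeniusP (S : set nat) : numerical_semigroup S ->
  is_frobenius S (frobenius S).
Proof.
move=> /numerical_semigroup_bound; set P := fun N => `[< forall n, N <= n -> S n >].
move=> [N0 SN0]; have exP : exists N, P N by exists N0; apply/asboolP.
case: (ex_minnP exP) => N /asboolP SN min_N.
apply: (@xgetPex _ 0%R (is_frobenius S)); exists (N%:Z - 1)%R; split.
  case=> n Sn nE; have NE : N = n.+1 by apply/eqP; rewrite -eqz_nat -addn1 PoszD nE subrK.
  have : N <= n; last by rewrite NE ltnn.
  apply: min_N; apply/asboolP => k; rewrite leq_eqVlt => /predU1P[<-//|].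
  by rewrite -NE; exact: SN.
move=> [n nS|n _].
  rewrite lerBrDr -PoszD lez_nat addn1 ltnNge; apply/negP => Nn.
  by apply: nS; exists n => //; exact: SN.
by rewrite NegzE; lia.
Qed.

(* Main.v *)
Require Import Defs.
From mathcomp Require Import all_boot all_order all_algebra.
From mathcomp Require Import finmap zify.
From mathcomp Require Import mathcomp_extra boolp classical_sets functions cardinality.
Local Open Scope classical_set_scope.

Import Order.TTheory.

(** Write x for the generator a_e being removed and g for the genus of S.

    The minimal generators of S are its atoms, the positive elements that are
    not sums of two positive elements of S ([minimal_generator_atom],
    [atom_generator]).  Hence S' = S \ {x} is again a numerical semigroup, of
    genus g + 1, and an atom of S other than x is still an atom of S'.

    The equivalence is a count of gaps.  If F is a gap of a semigroup, each pair
    (i, F - i) with 0 <= i <= F contains at least one gap, so F + 1 is at most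
    twice the genus ([gap_lt_genus]); when F is the largest gap, equality means
    that each pair contains exactly one gap, which is symmetry
    ([symmetric_genusP]).  If x = 2g + 1, every gap of S is below 2g, so x is the
    Frobenius number of S' and 2(g + 1) = x + 1 makes S' symmetric.  Conversely,
    let S' be symmetric with Frobenius number F >= x.  If F > x, then x being a
    gap of S' forces F - x to be in S', so F = x + (F - x) is in S and differs
    from x, a contradiction; hence F = x, and the genus formula for S' reads
    2(g + 1) = x + 1.

    Now let x = 2g + 1.  If e > 2, two generators m < p other than x are
    available, with m the multiplicity.  To see that S' is generated by the
    generators other than x, it suffices to subtract one of them from each
    positive n in S' and remain in S'.  The only doubtful case is n = x + t with t
    in S and t > 0: if t > m then n - m exceeds x, hence is in S'; if t = m
    then n - p = x - (p - m) is in S' by symmetry, because p - m is not in S by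
    irreducibility of p.  If e = 2 and m > 2, symmetry at 1 and 2 puts x - 1 and
    x - 2 in S, and both are multiples of m since they are below x; as m = 1
    would make x > 1 reducible, m = 2, and by symmetry S' consists of the even numbers and the odd numbers from
    x + 2 on. *)

(** * Generated submonoids and atoms *)

Lemma generated_submonoid (A : set nat) : submonoid (generated A).
Proof.
split; first by move=> M [[M0 _] _].
by move=> x y Ax Ay M MA; have [[_ MD] _] := MA; apply: MD; [exact: Ax|exact: Ay].
Qed.

Lemma sub_generated {A : set nat} : A `<=` generated A.
Proof. exact: sub_gen_smallest. Qed.

Lemma generated_sub {A M : set nat} :
  submonoid M -> A `<=` M -> generated A `<=` M.
Proof. by move=> hM; exact: smallest_sub. Qed.

Lemma generated_mull (A : set nat) x k : generated A x -> generated A (k * x).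
Proof.
have [A0 AD] := generated_submonoid A.
by move=> Ax; elim: k => [|k IH]; rewrite ?mul0n// mulSn; exact: AD.
Qed.

(** Used for induction: a positive element can be decreased by a generator. *)
Lemma generated_split {A : set nat} {n} : generated A n -> 0 < n ->
  exists c s, [/\ A c, generated A s & n = c + s].
Proof.
have [A0 AD] := generated_submonoid A.
suff: generated A `<=`
    [set n | generated A n /\
       (0 < n -> exists c s, [/\ A c, generated A s & n = c + s])].
  by move=> sub /sub[].
apply: generated_sub.
  split=> [//|x y [Ax hx] [Ay hy]]; split=> [|xy0]; first exact: AD.
  have [x0|x0] := posnP x; first by move: xy0; rewrite x0.
  have [c [s [Ac As ->]]] := hx x0; exists c, (s + y); split=> //.
    exact: AD.
  by rewrite addnA.
move=> x Ax; split=> [|_]; first exact: sub_generated.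
by exists x, 0; rewrite addn0.
Qed.

Definition atom (S : set nat) x :=
  [/\ S x, 0 < x & forall y z, S y -> S z -> x = y + z -> y = 0 \/ z = 0].

(** Fewer elements allow fewer decompositions. *)
Lemma atom_subset {S T : set nat} {x} : T `<=` S -> T x -> atom S x -> atom T x.
Proof. by move=> TS Tx [_ x0 hx]; split=> // y z /TS Sy /TS Sz; exact: hx. Qed.

(** The generated elements [n] for which [atom n] implies [A n] form a
    submonoid: a sum is an atom only if one of its terms is zero. *)
Lemma atom_generator {A : set nat} {x} : atom (generated A) x -> A x.
Proof.
move=> hx; have [Ax _ _] := hx.
suff sub : generated A `<=`
    [set n | generated A n /\ (atom (generated A) n -> A n)].
  by have [_] := sub _ Ax; apply.
have [A0 AD] := generated_submonoid A.
apply: generated_sub; last by move=> y Ay; split=> //; exact: sub_generated.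
split=> [|y z [Ay hy] [Az hz]]; first by split=> // -[].
split=> [|hyz]; first exact: AD.
have [_ _ h] := hyz.
have [y0|z0] := h y z Ay Az erefl.
  by move: hyz; rewrite y0 add0n; exact: hz.
by move: hyz; rewrite z0 addn0; exact: hy.
Qed.

(** The atoms lie in every generating set, so none of them can be dropped. *)
Lemma minimal_generating_of_atoms {S A : set nat} :
  generated A = S -> A `<=` atom S -> minimal_generating_set S A.
Proof.
move=> AS Aat; split=> // B BA BS; apply/seteqP; split=> // x /Aat.
by rewrite -BS; exact: atom_generator.
Qed.

(** If the generator [x] were a sum of two positive elements, these would be
    smaller than [x], hence generated without [x]; then [x] itself would be
    redundant. *)
Lemma minimal_generator_atom {S A : set nat} {x} :
  minimal_generating_set S A -> A x -> atom S x.
Proof.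
move=> [AS minA] Ax; set G := generated (A `\` [set x]).
have [G0 GD] : submonoid G := generated_submonoid _.
have nGx : ~ G x.
  move=> Gx; suff /minA AE : A `\` [set x] `<=` A.
    have /AE AxE : generated (A `\` [set x]) = S.
      rewrite -AS; apply/seteqP; split.
        by apply: generated_sub (generated_submonoid _) _ => y [/sub_generated].
      apply: generated_sub (generated_submonoid _) _ => y Ay.
      have [->|yx] := pselect (y = x); first exact: Gx.
      exact: sub_generated.
    by move: Ax; rewrite -AxE => -[_]; apply.
  by move=> y [].
(* The elements below x do not involve x. *)
have small : S `<=` [set n | x <= n \/ G n].
  rewrite -AS; apply: generated_sub.
    split; first by right.
    move=> y z /= [xy|Gy] [xz|Gz]; [left; lia..|by right; exact: GD].
  move=> y Ay; have [->|yx] := pselect (y = x); first by left.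
  by right; apply: sub_generated.
split; first by rewrite -AS; exact: sub_generated.
  by rewrite lt0n; apply/eqP => x0; apply: nGx; rewrite x0.
move=> y z /small hy /small hz xE.
case: hy => [|Gy]; first by right; lia.
case: hz => [|Gz]; first by left; lia.
by exfalso; apply: nGx; rewrite xE; exact: GD.
Qed.

Lemma atom_sub {S : set nat} {m p} :
  atom S p -> S m -> 0 < m < p -> ~ S (p - m).
Proof. by move=> [_ _ hp] Sm mp /(hp _ _ Sm); lia. Qed.

(** * Counting gaps *)

Definition gap_count (S : set nat) n := \sum_(0 <= i < n) ~~ `[< S i >].

Lemma gap_count_mono (S : set nat) m n :
  m <= n -> gap_count S m <= gap_count S n.
Proof. by move=> mn; rewrite /gap_count (big_cat_nat (leq0n m) mn)//= leq_addr. Qed.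

Lemma genus_gap_count {S : set nat} {N} :
  S 0 -> (forall n, N <= n -> S n) -> genus S = gap_count S N.
Proof.
move=> S0 SN; rewrite /genus /gap_count.
set s := [seq i <- index_iota 0 N | ~~ `[< S i >]].
have -> : [set n | 0 < n /\ ~ S n] = [set` [fset x in s]%fset].
  apply/seteqP; split=> n /=; rewrite inE/= mem_filter mem_index_iota /=.
    move=> [n0 nS]; apply/andP; split; first by apply/asboolP.
    by rewrite ltnNge; apply/negP => /SN.
  move=> /andP[/asboolP nS _]; split=> //.
  by case: n nS => // /(_ S0).
rewrite set_fsetK card_fseq undup_id ?filter_uniq ?iota_uniq//.
by rewrite size_filter -sum1_count big_mkcond/=; apply: eq_bigr => i _; case: ifP.
Qed.

(** The reflection [i |-> n - i] permutes [0, n], so it counts each gap twice. *)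
Lemma gap_count_pairs (S : set nat) n :
  2 * gap_count S n.+1 = \sum_(i < n.+1) (~~ `[< S i >] + ~~ `[< S (n - i) >]).
Proof.
rewrite big_split/= mul2n -addnn /gap_count big_mkord; congr (_ + _).
by rewrite (reindex_inj rev_ord_inj)/=; apply: eq_bigr => i _; rewrite subSS.
Qed.

Lemma gap_pair {S : set nat} {n i} : submonoid S -> ~ S n -> i <= n ->
  0 < ~~ `[< S i >] + ~~ `[< S (n - i) >].
Proof.
move=> [_ SD] nS ni; case: asboolP => //= Si; case: asboolP => //= Sni.
by exfalso; apply: nS; rewrite -(subnKC ni); exact: SD.
Qed.

(** Each of the [n + 1] pairs [(i, n - i)] contains a gap, and this counts each
    gap at most twice. *)
Lemma gap_lt_genus {S : set nat} {n} :
  numerical_semigroup S -> ~ S n -> n < 2 * genus S.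
Proof.
move=> hS nS; have [[S0 _] _] := hS.
have [N SN] := numerical_semigroup_bound hS.
have nN : n < N by rewrite ltnNge; apply/negP => /SN.
rewrite (genus_gap_count S0 SN).
apply: (@leq_trans (2 * gap_count S n.+1)); last first.
  by rewrite leq_mul2l; exact: gap_count_mono.
rewrite gap_count_pairs -[leqLHS]card_ord -sum1_card.
by apply: leq_sum => i _; apply: gap_pair (proj1 hS) nS _; rewrite -ltnS.
Qed.

(** The [F + 1] pairs [(i, F - i)] contain at least one gap each and twice the
    genus in total; equality of the two numbers means one gap in each pair. *)
Lemma symmetric_genusP {S : set nat} {F} :
  submonoid S -> ~ S F -> (forall n, F < n -> S n) ->
  2 * genus S = F.+1 <-> (forall i, i <= F -> S (F - i) <-> ~ S i).
Proof.
move=> hS nF SF; rewrite (genus_gap_count (proj1 hS) SF) gap_count_pairs.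
have: \sum_(i < F.+1) 1 <= \sum_(i < F.+1) (~~ `[< S i >] + ~~ `[< S (F - i) >])
   ?= iff [forall i : 'I_F.+1, 1 == ~~ `[< S i >] + ~~ `[< S (F - i) >]].
  apply: leqif_sum => i _; split=> //.
  by apply: gap_pair => //; rewrite -ltnS.
case=> _; rewrite sum1_card card_ord eq_sym => sumE; split.
  move=> /eqP; rewrite sumE => /forallP h i iF; have := h (Ordinal (iF : i < F.+1)).
  by move=> /=; case: asboolP; case: asboolP.
move=> h; apply/eqP; rewrite sumE; apply/forallP => i.
have /h : i <= F by rewrite -ltnS.
by case: asboolP => Si; case: asboolP => SFi; rewrite ?eqxx// => -[]; tauto.
Qed.

(** * The Frobenius number and symmetry *)

Lemma frobenius_eq {S : set nat} {F : int} : is_frobenius S F -> frobenius S = F.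
Proof.
move=> hF; apply: xget_unique => // G [nG hG].
by have [nF FF] := hF; apply/eqP; rewrite eq_le FF// hG.
Qed.

Lemma intset_Posz (S : set nat) n : intset S (Posz n) <-> S n.
Proof. by split=> [[m Sm [<-//]]|Sn]; exists n. Qed.

(** Outside of [0, F] the symmetry is automatic: negative integers are not in
    [S], and the integers above [F] are. *)
Lemma symmetric_natP {S : set nat} {F : nat} :
  ~ S F -> (forall n, F < n -> S n) ->
  symmetric_semigroup S <-> (forall i, i <= F -> S (F - i) <-> ~ S i).
Proof.
move=> nF SF.
have nneg (z : int) : (z < 0)%R -> ~ intset S z by move=> z0 [m _ mz]; lia.
have frobS : frobenius S = Posz F.
  apply: frobenius_eq; split; first by rewrite intset_Posz.
  case=> [n|n] nS; last by lia.
  rewrite lez_nat leqNgt; apply/negP => /SF Sn.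
  by apply: nS; apply/intset_Posz.
rewrite /symmetric_semigroup frobS; split=> [h i iF|h z].
  have := h (Posz i); have -> : (Posz F - Posz i)%R = Posz (F - i) by lia.
  by rewrite !intset_Posz; tauto.
case: z => [n|n]; last first.
  have -> : (Posz F - Negz n)%R = Posz (F + n.+1) by lia.
  right; split; first by apply: nneg.
  by apply/intset_Posz/SF; lia.
have [nF'|Fn] := leqP n F.
  have -> : (Posz F - Posz n)%R = Posz (F - n) by lia.
  rewrite !intset_Posz; have := h n nF'.
  by have [] := pselect (S n); tauto.
left; split; first by apply/intset_Posz/SF.
by apply: nneg; lia.
Qed.

(** * Removing an atom *)

Lemma remove_atom_numerical {S : set nat} {x} :
  numerical_semigroup S -> atom S x -> numerical_semigroup (S `\` [set x]).
Proof.
move=> [[S0 SD] finS] [_ x0 hx]; split; last first.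
  by rewrite setCD finite_setU; split=> //; exact: finite_set1.
split=> [|y z [Sy yx] [Sz zx]]; first by split=> //= ?; lia.
split; first exact: SD.
move=> /= xE; have [y0|z0] := hx y z Sy Sz (esym xE).
  by apply: zx => /=; lia.
by apply: yx => /=; lia.
Qed.

Lemma genus_remove_atom {S : set nat} {x} : numerical_semigroup S -> atom S x ->
  genus (S `\` [set x]) = (genus S).+1.
Proof.
move=> hS [Sx x0 _]; have [[S0 _] _] := hS.
have [N SN] := numerical_semigroup_bound hS.
rewrite (@genus_gap_count (S `\` [set x]) (maxn N x.+1)); first last.
- by move=> n; rewrite geq_max => /andP[/SN Sn xn]; split=> //= nx; lia.
- by split=> //= ?; lia.
rewrite (@genus_gap_count S (maxn N x.+1))//; last first.
  by move=> n; rewrite geq_max => /andP[/SN].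
rewrite /gap_count !big_mkord.
have xN : x < maxn N x.+1 by rewrite leq_max leqnn orbT.
rewrite (bigD1 (Ordinal xN))//= [in RHS](bigD1 (Ordinal xN))//=.
have -> : `[< S x >] = true by apply/asboolP.
have -> : `[< (S `\` [set x]) x >] = false by apply/asboolP => -[_]; apply.
rewrite add0n add1n; congr _.+1; apply: eq_bigr => i ix; congr (nat_of_bool (~~ _)).
apply/asboolP/asboolP => [[]//|Si]; split=> //= xE.
by move/eqP: ix; apply; exact: val_inj.
Qed.

(** Both sides force [x] to be the Frobenius number of [S `\` [set x]]; once this
    is known, [symmetric_genusP] for that semigroup, of genus [genus S + 1],
    gives the equivalence. *)
Lemma remove_atom_symmetricP {S : set nat} {x} :
  numerical_semigroup S -> atom S x ->
  x = 2 * genus S + 1 <-> symmetric_semigroup (S `\` [set x]).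
Proof.
move=> hS hx; have hS' := remove_atom_numerical hS hx.
have gS' := genus_remove_atom hS hx.
have [Sx x0 _] := hx; have nx : ~ (S `\` [set x]) x by case=> _; apply.
have [[S0 SD] _] := hS.
suff large : x = 2 * genus S + 1 \/ symmetric_semigroup (S `\` [set x]) ->
    forall n, x < n -> (S `\` [set x]) n.
  split=> [xE|symS].
    have xS := large (or_introl xE).
    apply/(symmetric_natP nx xS)/(symmetric_genusP (proj1 hS') nx xS).
    by rewrite gS'; lia.
  have xS := large (or_intror symS).
  have := (iffRL (symmetric_genusP (proj1 hS') nx xS)).
  by move=> /(_ (iffLR (symmetric_natP nx xS) symS)); rewrite gS'; lia.
move=> h n xn; split; last by move=> /= nx'; lia.
apply: contrapT => nS; case: h => [xE|symS].
  by have := gap_lt_genus hS nS; lia.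
(* Otherwise the Frobenius number F of S \ {x} exceeds x; symmetry at the gap x
   puts F - x, and then F = x + (F - x), in S. *)
have [nF maxF] := frobeniusP hS'.
have xF : (Posz x < frobenius (S `\` [set x]))%R.
  apply: (@lt_le_trans _ _ (Posz n)); first by lia.
  by apply: maxF; rewrite intset_Posz => -[].
case: (frobenius _) nF xF (symS (Posz x)) => [F|//] nF xF.
have -> : (Posz F - Posz x)%R = Posz (F - x) by lia.
rewrite !intset_Posz => -[[/nx//]|[_ [SFx _]]].
apply: nF; apply/intset_Posz; split; last by move=> /= Fx; lia.
have xF' : x <= F by lia.
by rewrite -(subnKC xF'); exact: SD.
Qed.

Lemma symmetric_at_atom {S : set nat} {x} :
  numerical_semigroup S -> atom S x -> x = 2 * genus S + 1 ->
  (forall n, x < n -> S n) /\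
  (forall i, i <= x -> (S `\` [set x]) (x - i) <-> ~ (S `\` [set x]) i).
Proof.
move=> hS hx xE.
have large n : x < n -> S n.
  move=> xn; apply: contrapT => /(gap_lt_genus hS); lia.
have nx : ~ (S `\` [set x]) x by case=> _; apply.
have xS n : x < n -> (S `\` [set x]) n.
  by move=> xn; split; [exact: large|move=> /= ?; lia].
split=> //; apply/(symmetric_natP nx xS).
exact/(remove_atom_symmetricP hS hx).
Qed.

(** * Multiplicity *)

Lemma multiplicity_eq {S : set nat} {m} : is_multiplicity S m -> multiplicity S = m.
Proof.
move=> [Sm m0 minm]; apply: xget_unique => // k [Sk k0 mink].
by apply/eqP; rewrite eqn_leq mink// minm.
Qed.

Lemma multiplicity_remove {S : set nat} {m x} :
  is_multiplicity S m -> x != m -> multiplicity (S `\` [set x]) = multiplicity S.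
Proof.
move=> hm xm; rewrite (multiplicity_eq hm); apply: multiplicity_eq.
have [Sm m0 minm] := hm; split=> //; last by move=> n [/minm].
by split=> //= mx; rewrite mx eqxx in xm.
Qed.

Lemma multiplicity_generator {S A : set nat} {m} : minimal_generating_set S A ->
  A m -> (forall c, A c -> m <= c) -> is_multiplicity S m.
Proof.
move=> minA Am lem; have [Sm m0 _] := minimal_generator_atom minA Am.
split=> // n; rewrite -(proj1 minA) => /generated_split h /h[c [s [Ac _ ->]]].
by have := lem c Ac; lia.
Qed.

(** * Generators after the removal *)

(** Every positive element of [S `\` [set x]] remains in that set after
    subtraction of a suitable generator other than [x]; the result follows by
    descent.  Two such generators [m] and [p] are needed: [x + m] loses [p], and
    the other elements of [x + S] lose [m]. *)
Lemma generated_remove_large {S A : set nat} {m p x} :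
  numerical_semigroup S -> minimal_generating_set S A ->
  is_multiplicity S m -> A m -> A p -> A x -> m < p -> x != m -> x != p ->
  x = 2 * genus S + 1 -> generated (A `\` [set x]) = S `\` [set x].
Proof.
move=> hS minA [Sm m0 minm] Am Ap Ax mp xm xp xE.
have hx := minimal_generator_atom minA Ax.
have hp := minimal_generator_atom minA Ap.
have [large sym] := symmetric_at_atom hS hx xE.
have [T0 TD] := generated_submonoid (A `\` [set x]).
have AS c : A c -> S c by rewrite -(proj1 minA); exact: sub_generated.
apply/seteqP; split.
  apply: generated_sub; first exact: (proj1 (remove_atom_numerical hS hx)).
  by move=> c [/AS].
suff step n : (S `\` [set x]) n -> 0 < n ->
    exists c s, [/\ (A `\` [set x]) c, (S `\` [set x]) s & n = c + s].
  move=> n; elim/ltn_ind: n => n IH S'n.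
  have [->//|n0] := posnP n.
  have [c [s [A'c S's nE]]] := step n S'n n0.
  have [_ c0 _] := minimal_generator_atom minA (proj1 A'c).
  rewrite nE; apply: TD; first exact: sub_generated.
  by apply: IH => //; lia.
move=> [Sn /= nx] n0.
have xS t : S t -> n = x + t ->
    exists c s, [/\ (A `\` [set x]) c, (S `\` [set x]) s & n = c + s].
  move=> St nE; have t0 : 0 < t by lia.
  have := minm t St t0; rewrite leq_eqVlt => /predU1P[tE|mt].
    have nSd : ~ S (p - m) by apply: (atom_sub hp Sm); rewrite m0.
    have px : p - m <= x by rewrite leqNgt; apply/negP => /large.
    exists p, (x - (p - m)); split; last by lia.
      by split=> //= px'; rewrite px' eqxx in xp.
    by apply/(sym _ px) => -[].
  exists m, (n - m); split; last by have := minm x (AS x Ax); lia.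
    by split=> //= mx; rewrite mx eqxx in xm.
  by split; [apply: large; lia|move=> /= ?; lia].
have [c [s [Ac As nE]]] : exists c s, [/\ A c, S s & n = c + s].
  by move: Sn; rewrite -(proj1 minA) => /generated_split; apply.
have [cx|cx] := pselect (c = x); first by apply: (xS s) => //; rewrite -cx.
have [sx|sx] := pselect (s = x).
  by apply: (xS c); [exact: AS|rewrite nE sx addnC].
by exists c, s.
Qed.

(** If [m > 2], symmetry at the gaps 1 and 2 puts [x - 1] and [x - 2] in [S];
    both are multiples of [m], being smaller than [x]. *)
Lemma two_generators_multiplicity {S : set nat} {m x} :
  numerical_semigroup S -> minimal_generating_set S [set m; x] -> m < x ->
  x = 2 * genus S + 1 -> m = 2.
Proof.
move=> hS minA mx xE.
have Ax : [set m; x] x by right.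
have Am : [set m; x] m by left.
have hx := minimal_generator_atom minA Ax.
have [Sm m0 hm] := minimal_generator_atom minA Am.
have [_ sym] := symmetric_at_atom hS hx xE.
have [_ _ minm] : is_multiplicity S m.
  by apply: multiplicity_generator minA _ _ => // c [->//|->]; exact: ltnW.
have mult n : S n -> n < x -> m %| n.
  move=> Sn nx; suff /(_ n Sn)[|//] : S `<=` [set n | x <= n \/ m %| n] by lia.
  rewrite -(proj1 minA); apply: generated_sub; last first.
    by move=> c [->|->]; [right|left].
  split=> [|y z /= [xy|my] [xz|mz]]; first by right; exact: dvdn0.
  - by left; lia.
  - by left; lia.
  - by left; lia.
  - by right; exact: dvdn_add.
have below i : 0 < i -> i < m -> m %| x - i.
  move=> i0 im; apply: mult; last by lia.
  suff [] : (S `\` [set x]) (x - i) by [].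
  apply/sym; first by lia.
  by case=> /minm; lia.
have m1 : m != 1.
  apply/eqP => m1; have [_ _ /(_ 1 x.-1)] := hx.
  have Sall k : S k.
    rewrite -(proj1 minA) -[k]muln1; apply: generated_mull; apply: sub_generated.
    by left.
  by move=> /(_ (Sall _) (Sall _)); lia.
apply/eqP; rewrite eqn_leq; apply/andP; split; last by lia.
rewrite leqNgt; apply/negP => m2.
have h1 := below 1 isT (ltnW m2); have h2 := below 2 isT m2.
have : m %| (x - 1) - (x - 2) by exact: dvdn_sub.
have -> : (x - 1) - (x - 2) = 1 by lia.
by rewrite dvdn1 (negbTE m1).
Qed.

(** Symmetry about the odd number [x] exchanges parities on [0, x]; as all even
    numbers are present, no odd number up to [x] is. *)
Lemma remove_from_multiplicity_two {S : set nat} {x} :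
  numerical_semigroup S -> atom S x -> is_multiplicity S 2 -> x = 2 * genus S + 1 ->
  minimal_generating_set (S `\` [set x]) [set 2; x + 2].
Proof.
move=> hS hx [S2 _ min2] xE.
have [large sym] := symmetric_at_atom hS hx xE.
have hS' := remove_atom_numerical hS hx; have [[S'0 S'D] _] := hS'.
have Seven k : (S `\` [set x]) (k * 2).
  split; last by move=> /= ?; lia.
  have [[S0 SD] _] := hS.
  by elim: k => // k IH; rewrite mulSn; exact: SD.
have Sodd n : (S `\` [set x]) n -> odd n -> x + 2 <= n.
  move=> S'n on; rewrite leqNgt; apply/negP => nx.
  have nlex : n <= x by lia.
  have /sym : n <= x by [].
  have -> : x - n = (x - n)./2 * 2 by lia.
  by have := Seven (x - n)./2; tauto.
have S'x : (S `\` [set x]) (x + 2).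
  by split; [apply: large; lia|move=> /= ?; lia].
have [T0 TD] := generated_submonoid [set 2; x + 2].
have Teven k : generated [set 2; x + 2] (k * 2).
  by apply: generated_mull; apply: sub_generated; left.
apply: minimal_generating_of_atoms.
  apply/seteqP; split.
    apply: generated_sub; first exact: (proj1 hS').
    by move=> c [->|->//]; exact: (Seven 1).
  move=> n S'n; have [on|en] := boolP (odd n).
    have := Sodd n S'n on => xn.
    suff -> : n = (x + 2) + (n - (x + 2))./2 * 2 by apply: TD => //; apply: sub_generated; right.
    by lia.
  suff -> : n = n./2 * 2 by [].
  by lia.
move=> c [->|->]; split=> //.
- exact: (Seven 1).
- by move=> y z [/min2 hy _] [/min2 hz _]; lia.
- by lia.
move=> y z /Sodd hy /Sodd hz yzE.
have [oy|ey] := boolP (odd y); first by right; have := hy oy; lia.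
by left; have := hz; lia.
Qed.

Theorem proposition2p3 (S : set nat) (a : seq nat)
    (hS : numerical_semigroup S) (ha : minimal_generators S a) :
  let e := size a in
  let a1 := head 0 a in
  let ae := last 0 a in
  let S' := S `\` [set ae] in
  (ae = 2 * genus S + 1 <-> numerical_semigroup S' /\ symmetric_semigroup S') /\
  (ae = 2 * genus S + 1 ->
    (e = 2 ->
      [/\ a1 = 2, minimal_generators S' [:: 2; ae + 2]
        & multiplicity S' = multiplicity S]) /\
    (2 < e ->
      minimal_generators S' (take e.-1 a) /\
      multiplicity S' = multiplicity S)).
Proof.
move=> e a1 ae S'; have [sa minA] := ha.
have a_gt0 : 0 < size a.
  case: a {e a1 ae S' sa ha} minA => // -[AS _].
  have [N SN] := numerical_semigroup_bound hS.
  have : generated [set` [::]] N.+1 by rewrite AS; exact: SN.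
  by move=> /generated_split => /(_ isT)[c [s []]].
have Aae : [set` a] ae by rewrite /= /ae -nth_last mem_nth// prednK.
have hae := minimal_generator_atom minA Aae.
have hS' := remove_atom_numerical hS hae.
split.
  by rewrite (remove_atom_symmetricP hS hae); split=> [|[]].
move=> aeE.
have nth_lt i j : i < j -> j < size a -> nth 0 a i < nth 0 a j.
  by move=> ij ja; apply: (sorted_ltn_nth ltn_trans) => //; rewrite inE; lia.
have a1m : is_multiplicity S a1.
  apply: multiplicity_generator minA _ _; first by rewrite /= /a1 -nth0 mem_nth.
  move=> c /= /(nthP 0)[i ia <-]; rewrite /a1 -nth0.
  by case: i ia => // i ia; apply/ltnW/nth_lt.
have mE : 1 < e -> multiplicity S' = multiplicity S.
  move=> e1; apply: multiplicity_remove a1m _.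
  by rewrite /ae /a1 -nth0 -nth_last gtn_eqF// nth_lt//; rewrite /e in e1; lia.
split=> e2; last first.
  split; last by apply: mE; lia.
  have a_uniq : uniq a := sorted_uniq ltn_trans ltnn sa.
  have takeE : [set` take e.-1 a] = [set` a] `\` [set ae].
    move: a_gt0 a_uniq; rewrite /ae /e.
    case/lastP: a {ha e a1 ae S' sa minA aeE nth_lt a1m mE Aae hae hS' e2} => // s y _.
    rewrite rcons_uniq size_rcons last_rcons -cats1 take_size_cat// => /andP[ys _].
    apply/seteqP; split=> c /=; rewrite mem_cat inE.
      by move=> cs; split; [rewrite cs|move=> cy; rewrite -cy cs in ys].
    by move=> [/orP[//|/eqP]].
  split; first exact: take_sorted.
  rewrite takeE; apply: minimal_generating_of_atoms.
    apply: (@generated_remove_large S _ a1 (nth 0 a 1)) => //=.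
    + by rewrite /a1 -nth0 mem_nth.
    + by rewrite mem_nth//; exact: ltnW.
    + by rewrite /a1 -nth0; apply: nth_lt => //; exact: ltnW.
    + by rewrite /ae /a1 -nth0 -nth_last gtn_eqF// nth_lt//; rewrite /e in e2; lia.
    + by rewrite /ae -nth_last gtn_eqF// nth_lt//; rewrite /e in e2; lia.
  move=> c [Ac cx]; have hc := minimal_generator_atom minA Ac.
  by have [Sc _ _] := hc; apply: atom_subset hc => // y [].
have setE : [set` a] = [set a1; ae].
  rewrite /a1 /ae; move: e2; rewrite /e.
  case: a {ha e a1 ae S' sa minA aeE nth_lt a1m mE Aae hae hS' a_gt0} => [|x [|y []]]//= _.
  apply/seteqP; split=> c /=; rewrite !inE.
    by move=> /orP[/eqP|/eqP]; [left|right].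
  by move=> [->|->]; rewrite eqxx ?orbT.
have a12 : a1 = 2.
  rewrite setE in minA; apply: two_generators_multiplicity hS minA _ aeE.
  by rewrite /ae /a1 -nth0 -nth_last nth_lt//; rewrite /e in e2; lia.
rewrite a12 in a1m; split=> //; last by apply: mE; rewrite e2.
split; first by rewrite /= andbT; lia.
have -> : [set` [:: 2; ae + 2]] = [set 2; ae + 2].
  apply/seteqP; split=> c /=; rewrite !inE.
    by move=> /orP[/eqP|/eqP]; [left|right].
  by move=> [->|->]; rewrite eqxx ?orbT.
exact: remove_from_multiplicity_two.
Qed.
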